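(* Let $\boldsymbol{k}$ be a field and work with $\mathbb N\times\mathbb N$ matrices over $\boldsymbol{k}$. For every $m\in\mathbb N$, $$\big(\oplus(\mathcal{I})-\ominus(\mathcal{I})\big)^{m}=\sum_{r=0}^m\binom{m}{r}(-1)^r\oplus^{m-2r}(\mathcal{I})\;+\;(-1)^m\sum_{l=0}^{\lfloor m/2\rfloor-1}\binom{m}{l}(-1)^l\mathcal{J}^{(a)}_{m-1-2l}.$$
   Context: $\mathcal{I}$ is the $\mathbb N\times\mathbb N$ identity matrix (indices start at 1). For $\mathcal{M}=(m_{i,j})_{i,j\ge1}$, $\oplus(\mathcal{M})$ has $(i,j)$ entry $m_{i-1,j}$ if $i>1$ and $0$ if $i=1$, and $\ominus(\mathcal{M})$ has $(i,j)$ entry $m_{i+1,j}$. For $s\ge0$, $\oplus^s$ and $\ominus^s$ denote $s$-fold iterates ($\oplus^0=\ominus^0=$ identity map), and $\oplus^{-s}:=\ominus^{s}$. Thus $\oplus(\mathcal{I})$ has ones on the subdiagonal and $\ominus(\mathcal{I})$ has ones on the superdiagonal. $\mathcal{J}^{(a)}_l$ is the matrix whose $(i,j)$ entry is $(-1)^{i-1}$ if $i+j=l+1$ and $0$ otherwise. Integer coefficients are interpreted in $\boldsymbol{k}$. *)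

(* Defs.v *)
From HB Require Import structures.
From mathcomp Require Import all_boot all_order all_algebra.
From mathcomp Require Import boolp classical_sets functions cardinality fsbigop.

Set Implicit Arguments.
Unset Strict Implicit.
Unset Printing Implicit Defensive.
Import GRing.Theory.
Local Open Scope classical_set_scope.
Local Open Scope ring_scope.

(* N x N matrices, with rows and columns numbered 1, 2, 3, ... : for
   M : nmx k, the Rocq term [M i j] is the entry in row i.+1, column j.+1.
   Only the module structure of [nat -> nat -> k^o] is transported to [nmx k]:
   its ring structure is pointwise, which is not the product of matrices. *)
Definition nmx (k : fieldType) : Type := nat -> nat -> k^o.

HB.instance Definition _ (k : fieldType) :=
  GRing.Lmodule.copy (nmx k) (nat -> nat -> k^o).

(* The matrix (E i j)_{i, j >= 1}, so that E is written with 1-based indices. *)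
Definition nmx_of (k : fieldType) (E : nat -> nat -> k) : nmx k :=
  fun i j => E i.+1 j.+1.

Definition nmx_id (k : fieldType) : nmx k :=
  nmx_of (fun i j => (i == j)%:R).

(* (A B)_{i,j} = sum_l A_{i,l} B_{l,j}, a sum with finite support as soon as A
   is row-finite or B is column-finite; by the convention on sums over
   [\in setT] the entry is 0 if the support is infinite. *)
Definition nmx_mul (k : fieldType) (A B : nmx k) : nmx k :=
  fun i j => \sum_(l \in [set: nat]) ((A i l : k) * (B l j : k)).

Definition nmx_exp (k : fieldType) (A : nmx k) (n : nat) : nmx k :=
  iter n (nmx_mul A) (nmx_id k).

Definition oplus (k : fieldType) (M : nmx k) : nmx k :=
  fun i j => if i is i'.+1 then M i' j else 0.

Definition ominus (k : fieldType) (M : nmx k) : nmx k :=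
  fun i j => M i.+1 j.

Definition oplus_exp (k : fieldType) (s : int) (M : nmx k) : nmx k :=
  match s with
  | Posz n => iter n (@oplus k) M
  | Negz n => iter n.+1 (@ominus k) M
  end.

Definition nmx_J (k : fieldType) (l : nat) : nmx k :=
  nmx_of (fun i j =>
    if (i + j == l + 1)%N then (-1) ^+ (i - 1) else 0).

(* Main.v *)
(** Left multiplication by [oplus I - ominus I] replaces row [i] of a matrix by
    row [i - 1] minus row [i + 1], row [- 1] being zero. The method of images
    removes this boundary: extended to all integers by [M (- 1) = 0] and
    [M (- 2 - n) = (- 1) ^+ n *: M n], the rows follow the same recurrence
    everywhere, even in characteristic 2, where the symmetry alone would not
    force row [- 1] to vanish. On sequences indexed by the integers the powers
    of the recurrence are given by signed binomial coefficients. Applied to the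
    identity matrix, the rows themselves contribute the first sum, and their
    images the sum of the [nmx_J]. *)
Require Import Defs.
From mathcomp Require Import all_boot all_algebra.
From mathcomp Require Import boolp classical_sets cardinality fsbigop.
From mathcomp Require Import zify.

Set Implicit Arguments.
Unset Strict Implicit.
Unset Printing Implicit Defensive.
Import GRing.Theory.
Local Open Scope ring_scope.

Section ShiftDifference.
Variables (R : pzRingType) (V : lmodType R).
Implicit Types (f : int -> V) (u : nat -> V) (d : int).

Definition shift_diff f : int -> V := fun d => f (d - 1) - f (d + 1).

Lemma iter_shift_diff m f d :
  iter m shift_diff f d =
  \sum_(0 <= r < m.+1) ('C(m, r)%:R * (-1) ^+ r) *: f (d - (m%:Z - (2 * r)%:Z)).
Proof.
elim: m d => [|m IHm] d; first by rewrite big_nat1 mulr1 scale1r subr0.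
rewrite iterS /shift_diff !IHm big_nat_recl // [RHS]big_nat_recl // !bin0.
under [in RHS]eq_bigr do rewrite binS natrD mulrDl scalerDl.
rewrite big_split /= addrA; congr (_ + _); last first.
  rewrite -sumrN; apply: eq_bigr => r _.
  by rewrite exprS mulN1r mulrN scaleNr; congr (- (_ *: f _)); lia.
rewrite big_nat_recr //= bin_small // mul0r scale0r.
congr (_ *: f _ + _); first lia.
by rewrite addr0; apply: eq_bigr => r _; congr (_ *: f _); lia.
Qed.

Definition shift_diff_nat u : nat -> V :=
  fun i => (if i is i'.+1 then u i' else 0) - u i.+1.

Definition image_ext u d : V :=
  match d with
  | Posz n => u n
  | Negz 0 => 0
  | Negz n.+1 => (-1) ^+ n *: u n
  end.

Lemma image_ext_shift_diff u :
  image_ext (shift_diff_nat u) = shift_diff (image_ext u).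
Proof.
apply/funext; rewrite /shift_diff /shift_diff_nat.
case=> [[|n]|[|[|n]]] /=.
- by [].
- by rewrite subn1 addn1.
- by rewrite expr0 scale1r subrr.
- by rewrite !addn0 subr0 sub0r scalerN expr1 scaleN1r expr0 scale1r.
- by rewrite !addn0 scalerBr addrC !exprS !mulN1r !scaleNr !opprK.
Qed.

End ShiftDifference.

Section NatMatrix.
Variable k : fieldType.
Implicit Types (A B M : nmx k) (m i j l : nat) (d : int).
Local Open Scope classical_set_scope.

Lemma nmx_addE A B i j : (A + B) i j = A i j + B i j.
Proof. by []. Qed.

Lemma nmx_scaleE (a : k) A i j : (a *: A) i j = a * A i j.
Proof. by []. Qed.

Lemma nmx_subE A B i j : (A - B) i j = A i j - B i j.
Proof. by []. Qed.

Lemma nmx_sumE (I : Type) (s : seq I) (F : I -> nmx k) i j :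
  (\sum_(x <- s) F x) i j = \sum_(x <- s) F x i j.
Proof. by elim/big_rec2: _ => // x y M _ <-. Qed.

Lemma nmx_idE i j : nmx_id k i j = (i == j)%:R.
Proof. by []. Qed.

Lemma nmx_mul_widen (S : set nat) A B i j :
    (forall l, A i l != 0 -> S l) ->
  nmx_mul A B i j = \sum_(l \in S) (A i l : k) * (B l j : k).
Proof.
move=> A_S; apply/esym/fsbig_widen => // l [_ Sl] /=.
by have [->|/A_S //] := eqVneq (A i l) 0; rewrite mul0r.
Qed.

Definition row_finite A := forall i, finite_set [set l | A i l != 0].

Lemma row_finite_id : row_finite (nmx_id k).
Proof.
move=> i; apply: sub_finite_set (finite_set1 i) => l /=.
by rewrite nmx_idE; case: (i =P l) => [->|]; rewrite ?eqxx.
Qed.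

Lemma row_finite_oplus A : row_finite A -> row_finite (oplus A).
Proof.
move=> finA [|i]; last exact: finA.
by apply: sub_finite_set (finite_set0 _) => l /=; rewrite eqxx.
Qed.

Lemma row_finite_ominus A : row_finite A -> row_finite (ominus A).
Proof. by move=> finA i; exact: finA. Qed.

Lemma nmx_mulBl A B M : row_finite A -> row_finite B ->
  nmx_mul (A - B) M = nmx_mul A M - nmx_mul B M.
Proof.
move=> finA finB; apply/funext => i; apply/funext => j.
pose S := [set l | A i l != 0] `|` [set l | B i l != 0].
have finS : finite_set S by rewrite finite_setU.
have AB_S l : (A - B) i l != 0 -> S l.
  rewrite /S /=; have [A0|] := eqVneq (A i l) 0; last by left.
  have [B0|] := eqVneq (B i l) 0; last by right.
  by rewrite nmx_subE A0 B0 subrr eqxx.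
rewrite nmx_subE !(@nmx_mul_widen S) //; [| by right | by left].
by rewrite !fsbig_finite // -sumrB; apply: eq_bigr => l _; rewrite -mulrBl.
Qed.

Lemma nmx_mul1l M : nmx_mul (nmx_id k) M = M.
Proof.
apply/funext => i; apply/funext => j; rewrite (@nmx_mul_widen [set i]).
  by rewrite fsbig_set1 nmx_idE eqxx mul1r.
by move=> l; rewrite nmx_idE; case: (i =P l) => [->|]; rewrite ?eqxx.
Qed.

Lemma nmx_mul_oplusl A M : nmx_mul (oplus A) M = oplus (nmx_mul A M).
Proof.
apply/funext => -[|i]; apply/funext => j //=.
by rewrite /nmx_mul fsbig1 // => l _; rewrite mul0r.
Qed.

Lemma nmx_mul_ominusl A M : nmx_mul (ominus A) M = ominus (nmx_mul A M).
Proof. by []. Qed.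

Local Notation shift_mx := (oplus (nmx_id k) - ominus (nmx_id k)).

Lemma nmx_mul_shift_mx M : nmx_mul shift_mx M = oplus M - ominus M.
Proof.
rewrite nmx_mulBl ?nmx_mul_oplusl ?nmx_mul_ominusl ?nmx_mul1l //.
- exact/row_finite_oplus/row_finite_id.
- exact/row_finite_ominus/row_finite_id.
Qed.

Definition col_nmx j M : nat -> k^o := M^~ j.

Lemma col_nmx_mul_shift_mx j M :
  col_nmx j (nmx_mul shift_mx M) = shift_diff_nat (col_nmx j M).
Proof. by rewrite nmx_mul_shift_mx; apply/funext => -[|i]. Qed.

Lemma image_ext_nmx_exp m j :
  image_ext (col_nmx j (nmx_exp shift_mx m)) =
  iter m (@shift_diff _ _) (image_ext (col_nmx j (nmx_id k))).
Proof.
elim: m => [//|m IHm].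
by rewrite iterS -IHm -image_ext_shift_diff -col_nmx_mul_shift_mx.
Qed.

Lemma nmx_exp_shift_mxE m i j :
  nmx_exp shift_mx m i j =
  \sum_(0 <= r < m.+1) 'C(m, r)%:R * (-1) ^+ r *
    image_ext (col_nmx j (nmx_id k)) (i%:Z - (m%:Z - (2 * r)%:Z)).
Proof.
rewrite -[LHS]/(image_ext (col_nmx j (nmx_exp shift_mx m)) i).
by rewrite image_ext_nmx_exp iter_shift_diff.
Qed.

Lemma iter_oplusE n M i j :
  iter n (@oplus k) M i j = if (n <= i)%N then M (i - n)%N j else 0.
Proof. by elim: n i => [|n IHn] [|i] //=; rewrite IHn. Qed.

Lemma iter_ominusE n M i j : iter n (@ominus k) M i j = M (i + n)%N j.
Proof.
by elim: n i => [|n IHn] i /=; rewrite ?addn0 // /ominus IHn addSnnS.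
Qed.

Lemma oplus_exp_idE d i j :
  oplus_exp d (nmx_id k) i j = (i%:Z - d == j%:Z)%:R.
Proof.
case: d => n; rewrite /oplus_exp ?iter_oplusE ?iter_ominusE ?nmx_idE.
  have -> : (i%:Z - n%:Z == j%:Z) = (n <= i)%N && (i - n == j)%N by lia.
  by case: leqP.
by congr (nat_of_bool _)%:R; lia.
Qed.

Lemma nmx_JE l i j : nmx_J k l i j = (-1) ^+ i * (i + j + 1 == l)%N%:R.
Proof.
rewrite /nmx_J /nmx_of subn1 addSn addnS !addn1 eqSS.
by case: eqP; rewrite ?mulr1 ?mulr0.
Qed.

Lemma image_ext_col_idE j d :
  image_ext (col_nmx j (nmx_id k)) d =
  (d == j%:Z)%:R + (-1) ^+ j * (d == - j%:Z - 2)%:R.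
Proof.
case: d => [n|[|n]] /=.
- by rewrite [X in _ * X%:R](_ : _ = false :> nat) ?mulr0 ?addr0 //; lia.
- by rewrite [X in _ * X%:R](_ : _ = false :> nat) ?mulr0 ?addr0 //; lia.
- rewrite add0r (_ : (Negz n.+1 == - j%:Z - 2) = (n == j)); last by lia.
  rewrite [col_nmx _ _ _]/((n == j)%:R).
  by case: (n =P j) => [->//|_]; rewrite scaler0 mulr0.
Qed.

Lemma image_nmx_JE m r i j : (r < m./2)%N ->
  (-1) ^+ j * (i%:Z - (m%:Z - (2 * r)%:Z) == - j%:Z - 2)%:R =
  (-1) ^+ m * nmx_J k (m - 1 - 2 * r) i j.
Proof.
move=> rm; rewrite nmx_JE.
have -> : (i%:Z - (m%:Z - (2 * r)%:Z) == - j%:Z - 2) =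
  (i + j + 1 == m - 1 - 2 * r)%N by lia.
case: eqP => [ijE|_]; rewrite ?mulr0 // !mulr1 -exprD.
by rewrite -[LHS]signr_odd -[RHS]signr_odd; congr (_ ^+ nat_of_bool _); lia.
Qed.

(* The images lie in the rows [d <= - 2], so the r-th term can reach one only if
   [2 * r <= m - 2], whence the range of [l]. *)
Lemma sum_image_nmx_J m i j (F : nat -> k) :
  \sum_(0 <= r < m.+1)
     F r * ((-1) ^+ j * (i%:Z - (m%:Z - (2 * r)%:Z) == - j%:Z - 2)%:R) =
  (-1) ^+ m * \sum_(0 <= l < m./2) F l * nmx_J k (m - 1 - 2 * l) i j.
Proof.
rewrite (@big_cat_nat _ _ _ m./2) //=; last by lia.
rewrite [X in _ + X]big_nat [X in _ + X]big1 ?addr0; last first.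
  move=> r /andP[mr _].
  have -> : (i%:Z - (m%:Z - (2 * r)%:Z) == - j%:Z - 2) = false by lia.
  by rewrite !mulr0.
rewrite mulr_sumr; apply: eq_big_nat => r /andP[_ rm].
by rewrite image_nmx_JE // mulrCA.
Qed.

End NatMatrix.

Theorem theorem3 (k : fieldType) (m : nat) :
  nmx_exp (oplus (nmx_id k) - ominus (nmx_id k)) m =
    \sum_(0 <= r < m.+1)
       ('C(m, r)%:R * (-1) ^+ r) *: oplus_exp (m%:Z - (2 * r)%:Z) (nmx_id k)
    + (-1) ^+ m *:
      \sum_(0 <= l < m./2)
         ('C(m, l)%:R * (-1) ^+ l) *: nmx_J k (m - 1 - 2 * l).
Proof.
apply/funext => i; apply/funext => j; rewrite nmx_exp_shift_mxE.
under eq_bigr do rewrite image_ext_col_idE mulrDr.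
rewrite big_split /= sum_image_nmx_J nmx_addE nmx_scaleE !nmx_sumE.
by congr (_ + _); apply: eq_bigr => r _; rewrite nmx_scaleE oplus_exp_idE.
Qed.
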